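(* Let $K\subset \mathbb S^2_+$ be origin-symmetric and star-shaped. Then $$\int_{S^1} \mathrm{vol}(K\cap\xi^\perp)^2\, d\xi\le \pi^2\,\mathrm{vol}(K),$$ with equality if and only if $K$ is a spherical cone.
   Context: $\mathbb S^2_+$ is the closed upper hemisphere of the unit sphere in $\mathbb R^3$, with its geodesic distance $\mathrm d$; the origin $o$ is the center (pole) of the hemisphere. $S^1$ is the unit circle in the tangent plane $T_o\mathbb S^2_+$, with arc-length measure $d\xi$ of total mass $2\pi$. For $\xi\in S^1$, $\xi^\perp$ is the geodesic line of $\mathbb S^2_+$ through $o$ with normal $\xi$ at $o$. $\mathrm{vol}$ is spherical area (for subsets of $\mathbb S^2_+$) or length (for subsets of $\xi^\perp$). A set $K$ is star-shaped if every geodesic through $o$ meets $K$ in a connected segment containing $o$; its radial function $\rho_K(\xi)\in[0,\pi/2]$ is the supremum of $\mathrm d(x,o)$ over the points $x\in K$ on the geodesic ray from $o$ in direction $\xi$. $K$ is origin-symmetric if $\rho_K(\xi)=\rho_K(-\xi)$ for all $\xi\in S^1$. Thus $\mathrm{vol}(K)=\int_{S^1}(1-\cos\rho_K(u))\,du$, and $\mathrm{vol}(K\cap\xi^\perp)$ is the sum of $\rho_K$ over the two unit vectors orthogonal to $\xi$. A star-shaped set is a spherical cone if its radial function is equal to $\pi/2$ on its support.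
   Formalization: The radial function is assumed measurable, and ''spherical cone'' is read up to null sets: the radial function equals π/2 at almost every direction where it is nonzero; read everywhere, ''only if'' fails, e.g. for a single segment through o of half-length 1. *)

(* Defs.v *)
From HB Require Import structures.
From mathcomp Require Import all_boot all_order all_algebra.
From mathcomp Require Import all_classical all_reals all_analysis.

Set Implicit Arguments.
Unset Strict Implicit.
Unset Printing Implicit Defensive.
Import Order.TTheory GRing.Theory Num.Theory.
Import numFieldNormedType.Exports.
Local Open Scope classical_set_scope.
Local Open Scope ring_scope.

(* A copy of the real line carrying the Lebesgue (not merely Borel)
   sigma-algebra, on which [completed_lebesgue_measure] is a measure. *)
Definition LebesgueType (R : realType) :=
  caratheodory_type (wlength (@idfun R))^*%mu.

Section hemisphere.
Context {R : realType}.
Implicit Types (x y xi : 'rV[R]_3) (A K : set 'rV[R]_3).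

Local Notation mu := (@completed_lebesgue_measure R).

Definition row3 (a b c : R) : 'rV[R]_3 := \row_(i < 3) [:: a; b; c]`_i.

Definition dotp x y : R := \sum_(i < 3) x 0 i * y 0 i.

Definition pole : 'rV[R]_3 := row3 0 0 1.

Definition hemisphere : set 'rV[R]_3 :=
  [set x | dotp x x = 1 /\ 0 <= dotp x pole].

Definition gdist x y : R := acos (dotp x y).

(* The tangent plane at the pole is identified with the plane of R^3 orthogonal
   to the pole. *)
Definition circle : set 'rV[R]_3 := [set xi | dotp xi xi = 1 /\ dotp xi pole = 0].

(* The unit-speed geodesic that leaves the pole in the direction [xi]. *)
Definition geod xi (t : R) : 'rV[R]_3 := cos t *: pole + sin t *: xi.

Definition ray xi : set 'rV[R]_3 := [set geod xi t | t in `[0, pi / 2]].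

Definition perp xi : set 'rV[R]_3 := [set x | hemisphere x /\ dotp x xi = 0].

(* Every geodesic of the hemisphere through the pole is some [perp xi]. *)
Definition star_shaped K := forall xi, circle xi ->
  (K `&` perp xi) pole /\ connected (K `&` perp xi).

Definition radial K xi : R := sup [set gdist x pole | x in K `&` ray xi].

Definition origin_symmetric K :=
  forall xi, circle xi -> radial K xi = radial K (- xi).

(* Arc-length parametrization of [circle]. *)
Definition dir (theta : R) : 'rV[R]_3 := row3 (cos theta) (sin theta) 0.

Definition circle_integral (F : 'rV[R]_3 -> \bar R) : \bar R :=
  (\int[mu]_(theta in `[0%R, (2 * pi)%R[) F (dir theta))%E.

Definition circle_ae (P : 'rV[R]_3 -> Prop) :=
  {ae mu, forall theta, (theta : R) \in `[0, 2 * pi[ -> P (dir theta)}.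

(* Measurability of the radial function. For a star-shaped set this amounts to
   Lebesgue measurability for the spherical area, since [K] contains the set of
   points at distance less than [radial K] and differs from it only along the
   graph of [radial K]. *)
Definition radial_measurable K :=
  measurable_fun [set: LebesgueType R] (fun theta => radial K (dir theta)).

(* Spherical area in geodesic polar coordinates, where the metric of the sphere
   is dt^2 + sin^2 t dtheta^2. *)
Definition area A : \bar R :=
  circle_integral (fun u =>
    (\int[mu]_(t in `[0%R, (pi / 2)%R]) (\1_A (geod u t) * sin t)%:E)%E).

Definition rot90 xi : 'rV[R]_3 := row3 (- xi 0 1) (xi 0 0) 0.

(* Length of a subset [A] of [perp xi], through the arc-length parametrization
   of [perp xi] by signed distance to the pole. *)
Definition perp_length xi A : \bar R :=
  mu [set t | (t : R) \in `[- (pi / 2), pi / 2] /\ A (geod (rot90 xi) t)].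

(* All the quantities considered only depend on the radial function up to null
   sets of directions, and so does this notion. The support of the radial
   function is the set where it does not vanish, not the closure of that set:
   the closure can have a strictly larger measure. *)
Definition spherical_cone K :=
  circle_ae (fun u => radial K u != 0 -> radial K u = pi / 2).

End hemisphere.

(* Main.v *)
Require Import Defs.
From mathcomp Require Import all_boot all_order all_algebra.
From mathcomp Require Import all_classical all_reals all_analysis.
From mathcomp Require Import measurable_realfun ring lra.
Import Order.TTheory GRing.Theory Num.Theory.
Import numFieldNormedType.Exports.
Local Open Scope classical_set_scope.
Local Open Scope ring_scope.

(** In geodesic polar coordinates around the pole both sides of the inequality
are integrals over the circle of a function of the radial function [r] of the
body. A star-shaped set meets the half great circle [perp xi] in an interval
of angles around the pole, whose ends are the values of [r] at the two
directions orthogonal to [xi]; by symmetry these agree, so the squared length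
is [4 * r ^+ 2], evaluated a quarter turn away from [xi]
([perp_length_radial], [perp_length_dir]). Integrating [sin] along a ray gives
[1 - cos r] as the area density ([integral_sin_ray]). A quarter turn does not
change an integral over the circle, because Lebesgue measure is translation
invariant and [r] is periodic ([ge0_integral_period]).

It remains to compare [4 * r ^+ 2] with [pi ^+ 2 * (1 - cos r)] for
[0 <= r <= pi / 2]. Since [1 - cos r = 2 * sin (r / 2) ^+ 2], this says that
the graph of [sin] on [0, pi / 4] lies above its chord, which is strict concavity
([chord_below_sin]): the inequality holds pointwise, with equality exactly at the
two ends [r = 0] and [r = pi / 2] of the chord ([diameter_le_cap],
[diameter_eq_cap]). The integrated inequality follows, and since the left-hand
integral is finite, equality of the integrals means equality almost everywhere
([ge0_eq_integral_ae]): almost every nonzero value of [r] is [pi / 2], that is,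
the body is a cone. *)

Set Implicit Arguments.
Unset Strict Implicit.

(** * Comparison of diameters and areas of spherical caps *)

Section trig.
Context {R : realType}.
Implicit Types r s b t : R.

(** By the mean value theorem the slopes of [sin] over [0, s] and [s, b] are
values of [cos] at a point before [s] and a point after [s]; [cos] is strictly
decreasing, so the first slope is the larger one. *)
Lemma chord_below_sin s b : 0 < s < b -> b <= pi -> s * sin b < b * sin s.
Proof.
move=> /andP[s0 sb] bpi.
have sin_mvt (x y : R) : x < y ->
    exists2 c, c \in `]x, y[ & sin y - sin x = cos c * (y - x).
  move=> xy; apply: (MVT xy).
  by apply: continuous_subspaceT => z; exact: continuous_sin.
have [c] := sin_mvt _ _ s0.
have [d] := sin_mvt _ _ sb.
rewrite !in_itv/= sin0 !subr0 => /andP[sd db] sinbs /andP[c0 cs] sins.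
have cosdc : cos d < cos c by rewrite ltr_cos ?in_itv/=; lra.
have : sin b - sin s < cos c * (b - s) by rewrite sinbs ltr_pM2r// subr_gt0.
by rewrite -(ltr_pM2l s0) sins; nra.
Qed.

Lemma sin2_half t : 2 * sin (t / 2) ^+ 2 = 1 - cos t.
Proof.
have := cos_mulr2n (t / 2); have := cos2Dsin2 (t / 2).
by rewrite (_ : t / 2 *+ 2 = t); [lra | rewrite mulr2n; lra].
Qed.

(** [2 * r] is the length of a diameter of the spherical cap of radius [r], and
[2 * pi * (1 - cos r)] is the area of that cap. The inequality is the square of
the chord inequality for [sin] on [0, pi / 4] at [r / 2], because
[2 * sin (pi / 4) ^+ 2 = 1]. *)
Lemma diameter_lt_cap r : 0 < r < pi / 2 ->
  4 * r ^+ 2 < pi ^+ 2 * (1 - cos r).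
Proof.
move=> /andP[r0 rpi]; have pi0 := pi_gt0 R.
have chord : r / 2 * sin (pi / 4) < pi / 4 * sin (r / 2).
  by apply: chord_below_sin; lra.
have sr0 : 0 < sin (r / 2) by rewrite sin_gt0_pi//; lra.
have sp0 : 0 < sin (pi / 4) :> R by rewrite sin_gt0_pi//; lra.
have sp : 2 * sin (pi / 4) ^+ 2 = 1 :> R.
  rewrite (_ : pi / 4 = (pi / 2) / 2); last by lra.
  by rewrite sin2_half cos_pihalf subr0.
rewrite -sin2_half.
have : (r / 2 * sin (pi / 4)) ^+ 2 < (pi / 4 * sin (r / 2)) ^+ 2.
  by rewrite ltr_pXn2r// nnegrE mulr_ge0//; lra.
rewrite !exprMn; nra.
Qed.

Lemma diameter_eq_cap r : 0 <= r <= pi / 2 ->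
  4 * r ^+ 2 = pi ^+ 2 * (1 - cos r) <-> (r != 0 -> r = pi / 2).
Proof.
move=> /andP[r0 rpi]; split=> [E rn0|].
  apply/eqP; rewrite eq_le rpi leNgt; apply/negP => rlt.
  by have := @diameter_lt_cap r; rewrite lt0r rn0 r0 rlt E ltxx => /(_ isT).
have [-> _|_ ->//] := eqVneq r 0; first by rewrite cos0; lra.
by rewrite cos_pihalf; lra.
Qed.

Lemma diameter_le_cap r : 0 <= r <= pi / 2 ->
  4 * r ^+ 2 <= pi ^+ 2 * (1 - cos r).
Proof.
move=> r0pi; have [rp|rnp] := boolP (0 < r < pi / 2).
  exact/ltW/diameter_lt_cap.
suff -> : 4 * r ^+ 2 = pi ^+ 2 * (1 - cos r) by [].
apply/(diameter_eq_cap r0pi) => rn0; move: r0pi rnp.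
by rewrite lt0r rn0 => /andP[-> /=]; rewrite le_eqVlt => /orP[/eqP|->].
Qed.
End trig.

(** * Integrals of nonnegative functions *)

(** Used for translations of the line, and for the identity seen as a map from
the Lebesgue sigma-algebra to the Borel one. *)
Lemma ge0_integral_measure_preserving d1 d2 (X : measurableType d1)
    (Y : measurableType d2) (R : realType) (m1 : {measure set X -> \bar R})
    (m2 : {measure set Y -> \bar R}) (phi : X -> Y) (D : set Y)
    (f : Y -> \bar R) :
  measurable_fun setT phi ->
  (forall A, measurable A -> m1 (phi @^-1` A) = m2 A) ->
  measurable D -> measurable_fun D f -> (forall y, D y -> 0 <= f y)%E ->
  (\int[m2]_(y in D) f y = \int[m1]_(x in phi @^-1` D) f (phi x))%E.
Proof.
move=> mphi m12 mD mf f0.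
rewrite -(ge0_integral_pushforward mphi m1)//; last first.
  by move=> y /[!inE]; exact: f0.
by apply: eq_measure_integral => A mA _; rewrite -m12.
Qed.

(** The difference [g - f] is nonnegative, and its integral is the difference of
the integrals because that of [f] is finite. *)
Lemma ge0_eq_integral_ae d (T : measurableType d) (R : realType)
    (m : {measure set T -> \bar R}) (D : set T) (f g : T -> R) :
  measurable D -> measurable_fun D f -> measurable_fun D g ->
  (forall x, D x -> 0 <= f x <= g x) ->
  (\int[m]_(x in D) (f x)%:E < +oo)%E ->
  (\int[m]_(x in D) (f x)%:E = \int[m]_(x in D) (g x)%:E)%E <->
  {ae m, forall x, D x -> f x = g x}.
Proof.
move=> mD mf mg fg foo.
have mh : measurable_fun D (fun x => (g x - f x)%:E).
  exact/measurable_EFinP/measurable_funB.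
have h0 x : D x -> (0 <= (g x - f x)%:E)%E.
  by move=> /fg/andP[_ fgx]; rewrite lee_fin subr_ge0.
have f0 x : D x -> (0 <= (f x)%:E)%E by move=> /fg/andP[]; rewrite lee_fin.
have gE : (\int[m]_(x in D) (g x)%:E =
    \int[m]_(x in D) (f x)%:E + \int[m]_(x in D) (g x - f x)%:E)%E.
  rewrite -ge0_integralD//; last exact/measurable_EFinP.
  by apply: eq_integral => x _; rewrite -EFinD subrKC.
have fin : (\int[m]_(x in D) (f x)%:E)%E \is a fin_num.
  by rewrite ge0_fin_numE// integral_ge0.
have absE : (\int[m]_(x in D) (g x - f x)%:E = \int[m]_(x in D) `|(g x - f x)%:E|)%E.
  by apply: eq_integral => x /[!inE] Dx; rewrite gee0_abs// h0.
have := ae_eq_integral_abs m mD mh.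
rewrite -absE gE => aeE; split.
  move=> fE; have /aeE : (\int[m]_(x in D) (g x - f x)%:E = 0)%E.
    by rewrite -[LHS](addeK _ fin) [X in (X - _)%E]addeC -fE subee.
  by apply: filterS => x /[apply] -[]; lra.
move=> fgae; rewrite aeE.2 ?adde0//.
by apply: filterS fgae => x /[apply] ->; rewrite subrr.
Qed.

Lemma measurable_diameter d (T : measurableType d) (R : realType) (D : set T)
    (r : T -> R) :
  measurable_fun D r -> measurable_fun D (fun x => 4 * r x ^+ 2).
Proof. by move=> mr; apply: measurable_funM => //; exact: measurable_funX. Qed.

Lemma measurable_cap d (T : measurableType d) (R : realType) (D : set T)
    (r : T -> R) :
  measurable_fun D r -> measurable_fun D (fun x => 1 - cos (r x)).
Proof.
move=> mr; apply: measurable_funB => //; apply: measurableT_comp mr.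
exact: (continuous_measurable_fun (@continuous_cos R)).
Qed.

(** The integrated form of the comparison between diameters and areas of caps.
The measure of [D] is finite so that the left-hand integral is finite, which the
equality case requires. *)
Lemma integral_diameter_cap d (T : measurableType d) (R : realType)
    (m : {measure set T -> \bar R}) (D : set T) (r : T -> R) :
  measurable D -> (m D < +oo)%E -> measurable_fun D r ->
  (forall x, 0 <= r x <= pi / 2) ->
  (\int[m]_(x in D) (4 * r x ^+ 2)%:E <=
   \int[m]_(x in D) (pi ^+ 2 * (1 - cos (r x)))%:E)%E /\
  ((\int[m]_(x in D) (4 * r x ^+ 2)%:E =
    \int[m]_(x in D) (pi ^+ 2 * (1 - cos (r x)))%:E)%E <->
   {ae m, forall x, D x -> r x != 0 -> r x = pi / 2}).
Proof.
move=> mD Doo mr rpi.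
have mf := measurable_diameter mr.
have mg : measurable_fun D (fun x => pi ^+ 2 * (1 - cos (r x))).
  by apply: measurable_funM => //; exact: measurable_cap.
have f0 x : 0 <= 4 * r x ^+ 2 by rewrite mulr_ge0 ?sqr_ge0.
have fg x : 4 * r x ^+ 2 <= pi ^+ 2 * (1 - cos (r x)) by exact: diameter_le_cap.
split.
  apply: ge0_le_integral => //; last by move=> x _; rewrite lee_fin.
  - by move=> x _; rewrite lee_fin.
  - exact/measurable_EFinP.
  - exact/measurable_EFinP.
have foo : (\int[m]_(x in D) (4 * r x ^+ 2)%:E < +oo)%E.
  apply: (@le_lt_trans _ _ (\int[m]_(x in D) (pi ^+ 2)%:E)%E).
    apply: ge0_le_integral => //.
    - by move=> x _; rewrite lee_fin.
    - exact/measurable_EFinP.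
    (* pi ^+ 2 is the value of 4 * r ^+ 2 at the largest radius pi / 2 *)
    - by move=> x _; have := rpi x; rewrite lee_fin; nra.
  by rewrite integral_cst// lte_mul_pinfty// lee_fin sqr_ge0.
rewrite (ge0_eq_integral_ae mD mf mg _ foo); last by move=> x _; rewrite f0 fg.
by split; apply: filterS => x + Dx => /(_ Dx)/(diameter_eq_cap (rpi x)).
Qed.

(** * Translation invariance of Lebesgue measure *)

Section lebesgue.
Context {R : realType}.
Local Notation mu := (@completed_lebesgue_measure R).
Local Notation translate a := (fun x : R => x + a)%R.
Local Notation hlength := (@wlength R idfun).

Lemma ocitv_shift (a : R) (A : set R) :
  ocitv A -> ocitv ((translate a) @^-1` A).
Proof.
move=> [[x y] _ <-]; exists (x - a, y - a) => //=.
by apply/seteqP; split => z /=; rewrite !in_itv/=; lra.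
Qed.

Lemma wlength_shift (a : R) (A : set R) :
  ocitv A -> hlength ((translate a) @^-1` A) = hlength A.
Proof.
move=> /ocitvP[->|[[x y] /= xy ->]]; first by rewrite preimage_set0.
rewrite (_ : _ @^-1` _ = `]x - a, y - a]%classic).
  rewrite !wlength_itv/= !lte_fin ltrD2r xy -!EFinD.
  by congr EFin; rewrite /idfun; lra.
by apply/seteqP; split => z /=; rewrite !in_itv/=; lra.
Qed.

(** The completed measure is an outer measure, the infimum of the total lengths
of covers by half-open intervals, so translating a cover proves this for an
arbitrary set; the Lebesgue measurability of a translate is deduced from it. *)
Lemma completed_lebesgue_measure_shift_le (a : R) (A : set R) :
  (mu ((translate a) @^-1` A) <= mu A)%E.
Proof.
apply: le_ereal_inf_tmp => _ [F [mF AF] <-].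
apply: ereal_inf_lbound => /=.
exists (fun n => (translate a) @^-1` F n).
  split=> [n|x /AF[n _ Fn]]; last by exists n.
  exact: ocitv_shift (mF n).
by apply: eq_eseriesr => n _; rewrite wlength_shift//; exact: mF.
Qed.

Lemma completed_lebesgue_measure_shift (a : R) (A : set R) :
  mu ((translate a) @^-1` A) = mu A.
Proof.
apply/eqP; rewrite eq_le completed_lebesgue_measure_shift_le/=.
have := completed_lebesgue_measure_shift_le (- a) ((translate a) @^-1` A).
rewrite -comp_preimage (_ : _ \o _ = id) ?preimage_id//.
by apply/funext => x /=; rewrite subrK.
Qed.

(** Caratheodory's criterion only involves the outer measure, which is
translation invariant. *)
Lemma measurable_lebesgue_shift (a : R) :
  measurable_fun setT ((translate a) : LebesgueType R -> LebesgueType R).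
Proof.
move=> _ A mA; rewrite setTI.
have mX X : mu X = (mu (X `&` A) + mu (X `&` ~` A))%E := mA X.
suff mpX X : mu X = (mu (X `&` (translate a) @^-1` A) +
    mu (X `&` ~` ((translate a) @^-1` A)))%E by move=> X; exact: mpX.
have XE : X = (translate a) @^-1` ((translate (- a)) @^-1` X).
  by apply/seteqP; split => x /=; rewrite addrK.
rewrite XE preimage_setC -!preimage_setI.
have sh B : mu ((translate a) @^-1` B) = mu B := completed_lebesgue_measure_shift a B.
by rewrite !sh; exact: mX.
Qed.

Lemma ge0_integral_shift (a : R) (D : set (LebesgueType R))
    (f : LebesgueType R -> \bar R) :
  measurable D -> measurable_fun D f -> (forall x, D x -> 0 <= f x)%E ->
  (\int[mu]_(x in D) f x =
   \int[mu]_(x in translate a @^-1` D) f ((x : R) + a)%R)%E.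
Proof.
move=> mD mf f0.
apply: (ge0_integral_measure_preserving (measurable_lebesgue_shift a)) => // A _.
exact: completed_lebesgue_measure_shift.
Qed.

Lemma measurable_borel_lebesgue :
  measurable_fun setT (id : LebesgueType R -> measurableTypeR R).
Proof. by move=> _ A mA; rewrite setTI; exact: sub_caratheodory. Qed.

Lemma ge0_integral_completed (D : set (measurableTypeR R))
    (f : measurableTypeR R -> \bar R) :
  measurable D -> measurable_fun D f -> (forall x, D x -> 0 <= f x)%E ->
  (\int[mu]_(x in D) f x = \int[lebesgue_measure]_(x in D) f x)%E.
Proof.
move=> mD mf f0.
by rewrite (ge0_integral_measure_preserving (m1 := mu) measurable_borel_lebesgue).
Qed.

Lemma completed_lebesgue_measure_itv (i : interval R) :
  mu [set` i] = lebesgue_measure [set` i].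
Proof. by []. Qed.

Lemma measurable_lebesgue_itv (i : interval R) :
  measurable ([set` i] : set (LebesgueType R)).
Proof.
rewrite -(setTI [set` i]).
exact: (measurable_borel_lebesgue measurableT (measurable_itv i)).
Qed.

(** The part of the shifted window [a, p + a[ that sticks out of [0, p[ is
moved back to [0, a[ by one period. *)
Lemma ge0_integral_period (p a : R) (f : LebesgueType R -> \bar R) :
  0 <= a <= p -> measurable_fun setT f -> (forall x, 0 <= f x)%E ->
  (forall x : R, f (x + p) = f x) ->
  (\int[mu]_(x in `[0%R, p[) f ((x : R) + a)%R = \int[mu]_(x in `[0%R, p[) f x)%E.
Proof.
move=> /andP[a0 ap] mf f0 fp.
have mfD (D : set (LebesgueType R)) : measurable D -> measurable_fun D f.
  by move=> mD; exact: measurable_funS mf.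
have shiftE (b x y : R) : (fun z => z + b) @^-1` `[x, y[ = `[x - b, y - b[%classic.
  by apply/seteqP; split => z /=; rewrite !in_itv/=; lra.
have splitE (x y z : R) : x <= y <= z ->
    (\int[mu]_(t in `[x, z[) f t =
     \int[mu]_(t in `[x, y[) f t + \int[mu]_(t in `[y, z[) f t)%E.
  move=> /andP[xy yz].
  rewrite -ge0_integral_setU//.
  - congr integral; apply/seteqP; split => t /=; rewrite !in_itv/=; last by lra.
    by move=> /andP[xt tz]; case: (ltP t y) => ty; [left|right]; lra.
  - exact: measurable_lebesgue_itv.
  - exact: measurable_lebesgue_itv.
  - by apply: mfD; apply: measurableU; exact: measurable_lebesgue_itv.
  - by rewrite disj_set2E; apply/eqP/seteqP; split => t //=; rewrite !in_itv/=; lra.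
transitivity (\int[mu]_(x in `[a, (p + a)%R[) f x)%E.
  rewrite [RHS](ge0_integral_shift a) ?shiftE ?subrr ?addrK//.
    exact: measurable_lebesgue_itv.
  exact/mfD/measurable_lebesgue_itv.
rewrite (splitE a p)//; last by lra.
rewrite [RHS](splitE 0 a)//; last by lra.
suff -> : (\int[mu]_(x in `[p, (p + a)%R[) f x = \int[mu]_(x in `[0%R, a[) f x)%E.
  by rewrite addeC.
rewrite (ge0_integral_shift p)//; first last.
- exact/mfD/measurable_lebesgue_itv.
- exact: measurable_lebesgue_itv.
rewrite shiftE subrr [p + a]addrC addrK.
by apply: eq_integral => x _; rewrite fp.
Qed.
End lebesgue.

(** * Geodesics and sections of star-shaped sets *)

Section geometry.
Context {R : realType}.
Implicit Types (x u xi : 'rV[R]_3) (K : set 'rV[R]_3) (t theta : R).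
Local Notation mu := (@completed_lebesgue_measure R).

Lemma row3E (a b c : R) : ((row3 a b c 0 0 = a) * (row3 a b c 0 1 = b) *
  (row3 a b c 0 2 = c))%type.
Proof. by rewrite !mxE. Qed.

Lemma eq_row3 x : x = row3 (x 0 0) (x 0 1) (x 0 2).
Proof.
apply/rowP => -[[|[|[|]]]]//= i; rewrite !mxE/=; congr (x 0 _); exact/val_inj.
Qed.

Lemma dotpE x u : dotp x u = x 0 0 * u 0 0 + x 0 1 * u 0 1 + x 0 2 * u 0 2.
Proof.
rewrite /dotp !big_ord_recl big_ord0 addr0 addrA.
by congr (_ + x 0 _ * u 0 _ + x 0 _ * u 0 _); exact/val_inj.
Qed.

Lemma circleE u : circle u <-> u 0 0 ^+ 2 + u 0 1 ^+ 2 = 1 /\ u 0 2 = 0.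
Proof. by rewrite /circle/= !dotpE !row3E; split=> -[]; nra. Qed.

Lemma circle_dir theta : circle (dir theta).
Proof. by apply/circleE; rewrite !row3E cos2Dsin2. Qed.

Lemma circle_rot90 xi : circle xi -> circle (rot90 xi).
Proof. by move=> /circleE[xi1 _]; apply/circleE; rewrite !row3E; lra. Qed.

Lemma circleN u : circle u -> circle (- u).
Proof. by move=> /circleE[u1 u2]; apply/circleE; rewrite !mxE; lra. Qed.

Lemma geodE u t : circle u ->
  geod u t = row3 (sin t * u 0 0) (sin t * u 0 1) (cos t).
Proof.
move=> /circleE[_ u2]; rewrite [LHS]eq_row3 /geod !(mxE, row3E)/= u2.
by congr row3; lra.
Qed.

Lemma geodN u t : geod (- u) t = geod u (- t).
Proof. by rewrite /geod cosN sinN scalerN scaleNr. Qed.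

Lemma rot90_dir theta : rot90 (dir theta) = dir (theta + pi / 2).
Proof. by rewrite /rot90 !row3E /dir cosDpihalf sinDpihalf. Qed.

Lemma dirDpi theta : dir (theta + pi) = - dir theta.
Proof.
rewrite [RHS]eq_row3 /dir !(mxE, row3E)/= cosDpi sinDpi.
by congr row3; lra.
Qed.

Lemma dotp_geod_pole u t : circle u -> dotp (geod u t) pole = cos t.
Proof. by move=> cu; rewrite geodE// dotpE !row3E; lra. Qed.

Lemma dotp_geod u t : circle u -> dotp (geod u t) u = sin t.
Proof.
move=> cu; rewrite geodE// dotpE !row3E.
move: cu => /circleE[u1 ->]; rewrite mulr0 addr0 -!mulrA -mulrDr.
by rewrite -!expr2 u1 mulr1.
Qed.

Lemma hemisphere_geod u t : circle u -> - (pi / 2) <= t <= pi / 2 ->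
  hemisphere (geod u t).
Proof.
move=> cu tpi; split; last by rewrite dotp_geod_pole// cos_ge0_pihalf.
rewrite geodE// dotpE !row3E; move: cu => /circleE[u1 _].
rewrite [RHS](esym (cos2Dsin2 t)) -(mulr1 (sin t ^+ 2)) -u1; lra.
Qed.

Lemma perp_geod xi t : circle xi -> - (pi / 2) <= t <= pi / 2 ->
  perp xi (geod (rot90 xi) t).
Proof.
move=> cxi tpi; split; first by apply: hemisphere_geod => //; exact: circle_rot90.
rewrite geodE; last exact: circle_rot90.
by rewrite dotpE !row3E; move: cxi => /circleE[_ ->]; lra.
Qed.

(** A point of the half great circle is determined by its coordinate along
[rot90 xi]: its height is nonnegative and is then fixed by the norm. *)
Lemma perp_eq_geod xi x t : circle xi -> perp xi x ->
  - (pi / 2) <= t <= pi / 2 -> dotp x (rot90 xi) = sin t ->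
  x = geod (rot90 xi) t.
Proof.
move=> cxi [[x1 x2] xxi] tpi xt; rewrite geodE; last exact: circle_rot90.
have ct := cos_ge0_pihalf tpi; have cs := cos2Dsin2 t.
move: cxi x1 x2 xxi xt; rewrite circleE !dotpE !row3E => -[xi1 xi2].
rewrite xi2 !mulr0 !addr0 !mulr1 !add0r => x1 x2 xxi xt.
have [p q] : x 0 0 = sin t * - xi 0 1 /\ x 0 1 = sin t * xi 0 0.
  have xxi0 := congr1 (fun z => z * xi 0 0) xxi.
  have xxi1 := congr1 (fun z => z * xi 0 1) xxi.
  by split; rewrite -xt -[LHS]mulr1 -xi1; move: xxi0 xxi1 => /=; lra.
rewrite [LHS]eq_row3 p q; congr row3.
apply/eqP; rewrite -(eqrXn2 (n := 2))//; apply/eqP.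
have : sin t ^+ 2 * (xi 0 0 ^+ 2 + xi 0 1 ^+ 2) + x 0 2 ^+ 2 = 1.
  by rewrite -x1 p q; lra.
by rewrite xi1; lra.
Qed.

Lemma continuous_dotp u : continuous (fun x => dotp x u).
Proof.
have coordM i c : continuous (fun x => x 0 i * c).
  by move=> x; apply: continuousM; [exact: coord_continuous|exact: cst_continuous].
under eq_fun do rewrite dotpE.
by move=> x; exact: (cvgD (cvgD (coordM 0 _ x) (coordM 1 _ x)) (coordM 2 _ x)).
Qed.

(** Connectedness is transported to the line by the linear coordinate along
[rot90 xi], which is [sin t] at angle [t]: it is continuous on the whole space,
and [sin] is increasing on [- (pi / 2), pi / 2]. *)
Lemma star_shaped_interval K xi : star_shaped K -> circle xi ->
  is_interval [set t | - (pi / 2) <= t <= pi / 2 /\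
                       (K `&` perp xi) (geod (rot90 xi) t)].
Proof.
move=> Kstar cxi; have [_ Kxi] := Kstar _ cxi.
have cr := circle_rot90 cxi.
have /connected_intervalP sI :
    connected ((fun x => dotp x (rot90 xi)) @` (K `&` perp xi)).
  apply: connected_continuous_connected => //.
  exact/continuous_subspaceT/continuous_dotp.
move=> s t /= [spi Ks] [tpi Kt] z /andP[sz zt].
have zpi : - (pi / 2) <= z <= pi / 2 by lra.
split=> //.
have [x Kx xz] : ((fun x => dotp x (rot90 xi)) @` (K `&` perp xi)) (sin z).
  apply: (sI (sin s) (sin t)).
  - by exists (geod (rot90 xi) s) => //; exact: dotp_geod.
  - by exists (geod (rot90 xi) t) => //; exact: dotp_geod.
  - by rewrite !leNgt !ltr_sin ?in_itv//= -!leNgt sz.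
by rewrite -(perp_eq_geod cxi Kx.2 zpi xz).
Qed.

Lemma radialE K u : circle u ->
  radial K u = sup [set t | 0 <= t <= pi / 2 /\ K (geod u t)].
Proof.
move=> cu; congr sup.
have gd t : 0 <= t <= pi / 2 -> gdist (geod u t) pole = t.
  move=> tpi; rewrite /gdist dotp_geod_pole// cosK// in_itv/=.
  by have := pi_gt0 R; lra.
apply/seteqP; split=> [_ [x [Kx [t /= tpi tx]] <-]|t [tpi Kt]].
  by move: tpi; rewrite in_itv/= => tpi; rewrite -tx gd// tx.
exists (geod u t); last exact: gd.
by split=> //; exists t => //=; rewrite in_itv.
Qed.

(** Each direction [u] lies on the geodesic [perp xi] for [xi = - rot90 u]. *)
Lemma rot90K u : circle u -> rot90 (- rot90 u) = u.
Proof.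
move=> /circleE[_ u2]; rewrite [RHS]eq_row3 u2 /rot90 !(mxE, row3E)/=.
by rewrite !opprK.
Qed.

(** Along a ray, a star-shaped set is known from the radial function except at
the distance [radial K u] itself, which may or may not be attained. *)
Lemma radialP K u : star_shaped K -> circle u ->
  [/\ 0 <= radial K u <= pi / 2,
      forall t, 0 <= t < radial K u -> K (geod u t) &
      forall t, 0 <= t <= pi / 2 -> K (geod u t) -> t <= radial K u].
Proof.
move=> Kstar cu; rewrite radialE//.
have pi0 := pi_gt0 R.
set S := [set t | _].
have cxi : circle (- rot90 u) by exact/circleN/circle_rot90.
have S0 : S 0.
  split; first by lra.
  have [[+ _] _] := Kstar _ cxi.
  by rewrite /geod sin0 cos0 scale1r scale0r addr0.
have Sub : ubound S (pi / 2) by move=> t [/andP[]].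
have Ssup : has_sup S by split; [exists 0|exists (pi / 2)].
have leS t : S t -> t <= sup S by move=> St; exact: ub_le_sup Ssup.2 _ St.
split=> [|t /andP[t0 tS]|t tpi Kt]; last exact: leS.
  by rewrite leS//= ge_sup//; exists 0.
have [s Ss ts] := sup_gt (ex_intro _ _ S0) tS.
have [spi Ks] := Ss.
have Sgeod r : 0 <= r <= pi / 2 -> K (geod u r) ->
    - (pi / 2) <= r <= pi / 2 /\
    (K `&` perp (- rot90 u)) (geod (rot90 (- rot90 u)) r).
  move=> rpi Kr; split; first by lra.
  split; first by rewrite rot90K.
  by apply: perp_geod => //; lra.
have := star_shaped_interval Kstar cxi (Sgeod _ S0.1 S0.2) (Sgeod _ spi Ks).
have ts' : 0 <= t <= s by lra.
by move=> /(_ t ts')[_ [+ _]]; rewrite rot90K.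
Qed.

(** The set of angles lies between an open and a closed interval with the same
ends, and the outer measure is monotone on arbitrary sets. *)
Lemma perp_length_radial K xi : star_shaped K -> circle xi ->
  perp_length xi (K `&` perp xi) =
  (radial K (rot90 xi) + radial K (- rot90 xi))%:E.
Proof.
move=> Kstar cxi; have cr := circle_rot90 cxi.
have [rpi rK Kr] := radialP Kstar cr.
have [spi sK Ks] := radialP Kstar (circleN cr).
set r := radial K (rot90 xi) in rpi rK Kr *.
set s := radial K (- rot90 xi) in spi sK Ks *.
have itvE b1 b2 : mu [set` Interval (BSide b1 (- s)) (BSide b2 r)] = (r + s)%:E.
  rewrite completed_lebesgue_measure_itv lebesgue_measure_itv/= lte_fin.
  case: ltP => sr; first by rewrite -EFinD opprK.
  by congr EFin; lra.
apply/eqP; rewrite eq_le; apply/andP; split.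
- rewrite -(itvE true false); apply: le_mu_ext => t [/=].
  rewrite !in_itv/= => tpi [Kt _]; case: (leP 0 t) => t0.
    have : t <= r by apply: Kr => //; lra.
    by lra.
  have : - t <= s by apply: Ks; rewrite ?geodN ?opprK//; lra.
  by lra.
- rewrite -(itvE false true); apply: le_mu_ext => t /=; rewrite in_itv/= => srt.
  have tpi : - (pi / 2) <= t <= pi / 2 by lra.
  split; first by rewrite in_itv.
  split; last exact: perp_geod.
  case: (leP 0 t) => t0; first by apply: rK; lra.
  have := sK (- t); rewrite geodN opprK; apply; lra.
Qed.

Lemma integral_sin (r : R) : 0 <= r ->
  (\int[lebesgue_measure]_(t in `[0%R, r]) (sin t)%:E = (1 - cos r)%:E)%E.
Proof.
rewrite le_eqVlt => /predU1P[<-|r0].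
  by rewrite set_itv1 integral_set1 cos0 subrr.
rewrite (@continuous_FTC2 _ sin (fun t => - cos t))//.
- by rewrite -EFinB cos0; congr EFin; lra.
- exact/continuous_subspaceT/continuous_sin.
- split=> [t _||].
  + exact: derivableN.
  + apply: cvg_at_right_filter; apply: cvgN; exact: continuous_cos.
  + apply: cvg_at_left_filter; apply: cvgN; exact: continuous_cos.
- by move=> t _; rewrite derive1E deriveN// derive_val opprK.
Qed.

Lemma measurable_sin (D : set (measurableTypeR R)) :
  measurable_fun D (fun t => (sin t)%:E).
Proof.
apply/measurable_EFinP/measurable_funTS.
exact: (continuous_measurable_fun (@continuous_sin R)).
Qed.

Lemma integral_sin_ray K u : star_shaped K -> circle u ->
  (\int[mu]_(t in `[0%R, (pi / 2)%R]) (\1_K (geod u t) * sin t)%:E =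
   (1 - cos (radial K u))%:E)%E.
Proof.
move=> Kstar cu; have [rpi rK Kr] := radialP Kstar cu.
set r := radial K u in rpi rK Kr *.
have sinE b : (\int[mu]_(t in [set` Interval (BLeft 0%R) (BSide b r)]) (sin t)%:E =
    (1 - cos r)%:E)%E.
  rewrite ge0_integral_completed.
  - have r0 : 0 <= r by lra.
    case: b; last exact: integral_sin.
    by rewrite integral_itv_bndo_bndc; [exact: integral_sin|exact: measurable_sin].
  - exact: measurable_itv.
  - exact: measurable_sin.
  - move=> t /=; rewrite in_itv/= lee_fin => /andP[t0].
    by case: b => /= tr; rewrite sin_ge0_pi//; have := pi_gt0 R; lra.
pose T := [set t | K (geod u t)].
transitivity (\int[mu]_(t in `[0%R, (pi / 2)%R] `&` T) (sin t)%:E)%E.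
  rewrite integral_mkcondr; apply: eq_integral => t _.
  rewrite patchE indicE (_ : (geod u t \in K) = (t \in T)).
    by case: ifP; rewrite ?mul1r ?mul0r.
  by apply/idP/idP; rewrite !inE.
(* T is [0, r] or [0, r[, according to whether the supremum is attained *)
have [Krr|Krr] := pselect (K (geod u r)).
  rewrite -(sinE false); congr integral; apply/seteqP; split=> t /=; rewrite !in_itv/=.
    by move=> [tpi Kt]; have := Kr _ tpi Kt; lra.
  move=> /andP[t0]; rewrite le_eqVlt => /predU1P[->|tr]; first by split => //; lra.
  by split; [lra|apply: rK; lra].
rewrite -(sinE true); congr integral; apply/seteqP; split=> t /=; rewrite !in_itv/=.
  move=> [tpi Kt]; have : t < r; last by lra.
  rewrite lt_neqAle Kr// andbT.
  by apply/eqP => tr; apply: Krr; rewrite -tr.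
by move=> tr; split; [lra|apply: rK; lra].
Qed.
End geometry.

(** * The integral inequality *)

Section main.
Context {R : realType}.
Implicit Types (K : set 'rV[R]_3) (xi : 'rV[R]_3).
Local Notation mu := (@completed_lebesgue_measure R).

(** The two directions orthogonal to [dir theta] are opposite, so that symmetry
makes the two half-lengths equal. *)
Lemma perp_length_dir K theta : star_shaped K -> origin_symmetric K ->
  perp_length (dir theta) (K `&` perp (dir theta)) =
  (2 * radial K (dir (theta + pi / 2)))%:E.
Proof.
move=> Kstar Ksym; rewrite perp_length_radial//; last exact: circle_dir.
rewrite rot90_dir -Ksym; last exact: circle_dir.
by congr EFin; lra.
Qed.

Lemma radial_dirD2pi K theta :
  radial K (dir (theta + 2 * pi)) = radial K (dir theta).
Proof.
by rewrite (_ : theta + 2 * pi = theta + pi + pi) ?dirDpi ?opprK//; lra.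
Qed.

Lemma radial_dir_itv K theta : star_shaped K ->
  0 <= radial K (dir theta) <= pi / 2.
Proof. by move=> Kstar; have [] := radialP Kstar (circle_dir theta). Qed.

(** A quarter turn removes the rotation between [xi] and the directions of
[perp xi]. *)
Lemma circle_integral_perp_length K : radial_measurable K ->
  origin_symmetric K -> star_shaped K ->
  (circle_integral (fun xi => perp_length xi (K `&` perp xi) ^+ 2) =
   \int[mu]_(theta in `[0%R, (2 * pi)%R[) (4 * radial K (dir theta) ^+ 2)%:E)%E.
Proof.
move=> Kmeas Ksym Kstar; rewrite /circle_integral.
have pi0 := pi_gt0 R.
rewrite -(@ge0_integral_period _ (2 * pi) (pi / 2)
  (fun theta => (4 * radial K (dir theta) ^+ 2)%:E)).
- apply: eq_integral => theta _.
  by rewrite perp_length_dir// -EFin_expe exprMn; congr (_ * _)%:E; lra.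
- by lra.
- exact/measurable_EFinP/measurable_diameter.
- by move=> theta; rewrite lee_fin mulr_ge0// sqr_ge0.
- by move=> theta; rewrite radial_dirD2pi.
Qed.

Lemma area_radial K : radial_measurable K -> star_shaped K ->
  ((pi ^+ 2)%:E * area K =
   \int[mu]_(theta in `[0%R, (2 * pi)%R[)
     (pi ^+ 2 * (1 - cos (radial K (dir theta))))%:E)%E.
Proof.
move=> Kmeas Kstar; rewrite /area /circle_integral.
under eq_integral => theta _.
  by rewrite (integral_sin_ray Kstar (circle_dir theta)); over.
rewrite -ge0_integralZl.
- by apply: eq_integral => theta _; rewrite -EFinM.
- exact: measurable_lebesgue_itv.
- exact/measurable_EFinP/measurable_cap/measurable_funTS.
- by move=> theta _; rewrite lee_fin subr_ge0 cos_le1.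
- by rewrite lee_fin sqr_ge0.
Qed.
End main.

Local Open Scope ereal_scope.

Theorem theorem5p2 (R : realType) (K : set 'rV[R]_3)
    (K_hemisphere : K `<=` hemisphere)
    (K_measurable : radial_measurable K)
    (K_symmetric : origin_symmetric K)
    (K_star : star_shaped K) :
  circle_integral (fun xi => perp_length xi (K `&` perp xi) ^+ 2)
    <= (pi ^+ 2)%:E * area K /\
  (circle_integral (fun xi => perp_length xi (K `&` perp xi) ^+ 2)
    = (pi ^+ 2)%:E * area K <-> spherical_cone K).
Proof.
rewrite circle_integral_perp_length// area_radial//.
set D : set (LebesgueType R) := `[0%R, (2 * pi)%R[%classic.
have mD : measurable D by exact: measurable_lebesgue_itv.
have Doo : completed_lebesgue_measure D < +oo.
  rewrite completed_lebesgue_measure_itv lebesgue_measure_itv.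
  by case: ifP; rewrite -?EFinB ltry.
have mr : measurable_fun D (fun theta => radial K (dir theta)).
  exact: measurable_funTS.
have rpi theta := radial_dir_itv theta K_star.
exact: (integral_diameter_cap mD Doo mr rpi).
Qed.
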